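(* Let $g$ and $l$ satisfy the structural assumptions A1 and A2 listed in the context, with constants $\bar g,\bar g_2,\bar l,\bar l_1,\bar l_2,c_0,c_s,\bar c>0$. Define $$C_1=\sqrt{\frac{\bar c\,\bar l\,(1+\frac{c_0}{\bar l_1})}{\bar g\,\bar l_1}}+\frac{c_0}{\bar l_1},\qquad C_2=\frac{1}{c_s}\left(\bar l_2+\sqrt{c_s\bar l_2+\bar l_2^2+\bar g_2\sqrt{\frac{c_s(\bar l^2+c_0\bar l)}{\bar g}}}\right),$$ $$C_3=\sqrt{\frac{\bar l_1\,\bar l\,(1+\frac{c_0}{\bar l_1})}{\bar g\,\bar c}},\qquad C_4=\frac1{\bar c}\sqrt{c_s\bar l_2+\bar l_2^2+\bar g_2\sqrt{\frac{c_s(\bar l^2+c_0\bar l)}{\bar g}}}.$$ Then there exists a constant $\rho_1$ such that, if $\rho>\rho_1$ and the initial value-gradient function $\lambda^{(0)}$ of the policy iteration (PI-lambda) described in the context satisfies $$\|\lambda^{(0)}(x)\|\le C_3(1+\|x\|),\qquad \|D\lambda^{(0)}(x)\|\le C_4\qquad\text{for all }x\in\mathbb{R}^d,$$ then the sequences of bounding constants $\{\bar a^{(k)}\}$, $\{\bar a'^{(k)}\}$, $\{\bar\lambda^{(k)}\}$, $\{\bar\lambda'^{(k)}\}$ defined in the context are uniformly bounded (over all $k$) by $C_1$, $C_2$, $C_3$, $C_4$ respectively.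
   Context: Notation: $x\in\mathbb{R}^d$ is the state, $a\in\mathbb{R}^p$ the control, $\rho\ge 0$ the discount factor; $\nabla$ and $\nabla\nabla^\top$ denote gradient and matrix of second derivatives of a scalar function (in the indicated variables); $D$ is the Jacobian matrix of a vector-valued function, e.g. $D_xg(x,a)$ has $(i,j)$ entry $\partial g_i/\partial x_j$. Assumptions: there exist positive constants $\bar g,\bar g_2,\bar l,\bar l_1,\bar l_2,c_0,c_s$ and a matrix $c\in\mathbb{R}^{p\times d}$ with norm $\|c\|=\bar c$ such that: A1. $g:\mathbb{R}^d\times\mathbb{R}^p\to\mathbb{R}^d$ has the form $g(x,a)=g_1(x)+c^\top a$, and $\|g(x,a)\|\le\bar g(1+\|x\|+\|a\|)$, $\|D_xg(x,a)\|\le\bar g$, $\sum_{i=1}^d\|D_x(\partial_{x_i}g(x,a))\|\le \frac{\bar g_2}{1+\|x\|}$. A2. $l:\mathbb{R}^d\times\mathbb{R}^p\to\mathbb{R}$ is strictly convex and satisfies $|l(x,a)|\le\bar l(1+\|x\|^2+\|a\|^2)$; $|l(x,a)-l(x',a')|\le\bar l\,(1+\max(\|x\|,\|x'\|)+\max(\|a\|,\|a'\|))(\|x-x'\|+\|a-a'\|)$; $\|\nabla_al(x,a)\|\ge\bar l_1\|a\|-c_0$; $\|(\nabla_a\nabla_a^\top)l(x,a)\|\ge c_s$; and $\|(\nabla_x\nabla_a^\top)l(x,a)\|$, $\|(\nabla_a\nabla_x^\top)l(x,a)\|$, $\|(\nabla_x\nabla_x^\top)l(x,a)\|$ are bounded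 above by $\bar l_2$. PI-lambda iteration: starting from a continuously differentiable $\lambda^{(0)}:\mathbb{R}^d\to\mathbb{R}^d$, for each $k\ge0$ set $$a^{(k)}(x)=\operatorname{argmin}_{a\in\mathbb{R}^p}\,[\,g(x,a)\cdot\lambda^{(k)}(x)+l(x,a)\,]$$ (minimizer assumed unique and continuously differentiable), and let $\lambda^{(k+1)}$ be the solution, given by the method of characteristics, of $$\rho\lambda_i^{(k+1)}(x)-\nabla\lambda_i^{(k+1)}(x)\cdot g(x,a^{(k)}(x))=\sum_{n=1}^d\frac{\partial g_n}{\partial x_i}(x,a^{(k)}(x))\,\lambda_n^{(k)}(x)+\frac{\partial l}{\partial x_i}(x,a^{(k)}(x)),\quad i=1,\dots,d.$$ Bounding constants: $\bar\lambda^{(0)}\in(0,C_3]$ and $\bar\lambda'^{(0)}\in(0,C_4]$ are constants with $\|\lambda^{(0)}(x)\|\le\bar\lambda^{(0)}(1+\|x\|)$ and $\|D\lambda^{(0)}(x)\|\le\bar\lambda'^{(0)}$ for all $x$; and recursively, for $k\ge0$, $$\bar a^{(k)}=\frac{\bar c\,\bar\lambda^{(k)}+c_0}{\bar l_1},\qquad \bar a'^{(k)}=\frac{\bar l_2+\bar c\,\bar\lambda'^{(k)}}{c_s},$$ $$\bar\lambda^{(k+1)}=\frac{\bar l+\bar l\,\bar a^{(k)}+\bar g\,\bar\lambda^{(k)}}{\rho-\bar g(1+\bar a^{(k)})},\qquad \bar\lambda'^{(k+1)}=\frac{\bar l_2+\bar l_2\,\bar a'^{(k)}+\bar g_2\,\bar\lambda^{(k)}+\bar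 g\,\bar\lambda'^{(k)}}{\rho-(\bar g+\bar c\,\bar a'^{(k)})}.$$ These are the constants bounding the iterates in the sense $\|\lambda^{(k)}(x)\|\le\bar\lambda^{(k)}(1+\|x\|)$, $\|D\lambda^{(k)}(x)\|\le\bar\lambda'^{(k)}$, $\|a^{(k)}(x)\|\le\bar a^{(k)}(1+\|x\|)$, $\|Da^{(k)}(x)\|\le\bar a'^{(k)}$. *)

(* Defs.v *)
From HB Require Import structures.
From mathcomp Require Import all_boot all_order all_algebra.
From mathcomp Require Import all_classical all_reals all_analysis.

Set Implicit Arguments.
Unset Strict Implicit.
Unset Printing Implicit Defensive.
Import Order.TTheory GRing.Theory Num.Theory.
Import numFieldNormedType.Exports.

Local Open Scope classical_set_scope.
Local Open Scope ring_scope.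

(* Elements of R^n are row vectors.  The library norm on matrices is the
   max norm, which gives the usual topology and differentiability; the
   quantitative bounds use the Euclidean norm on vectors and the operator norm
   it induces on matrices. *)
Section EuclideanNorms.
Context {R : realType}.

Definition dot n (u v : 'rV[R]_n) : R := \sum_i u 0 i * v 0 i.

Definition enorm n (u : 'rV[R]_n) : R := Num.sqrt (dot u u).

(* [v *m A^T] is the row form of the column vector A v. *)
Definition opnorm m n (A : 'M[R]_(m, n)) : R :=
  sup [set enorm (v *m A^T) | v in [set v : 'rV[R]_n | enorm v <= 1]].

End EuclideanNorms.

Section Derivatives.
Context {R : realType}.

Definition basis_vec n (i : 'I_n) : 'rV[R]_n := delta_mx 0 i.

(* The library's [jacobian] acts on row vectors on the right, so its (i, j)
   entry is d f_j / d x_i; the transpose has (i, j) entry d f_i / d x_j. *)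
Definition Dmx n m (f : 'rV[R]_n -> 'rV[R]_m) (x : 'rV[R]_n) : 'M[R]_(m, n) :=
  (jacobian f x)^T.

Definition grad n (f : 'rV[R]_n -> R) (x : 'rV[R]_n) : 'rV[R]_n :=
  \row_i 'D_(basis_vec i) f x.

Definition continuously_differentiable n m (f : 'rV[R]_n -> 'rV[R]_m) : Prop :=
  (forall x, differentiable f x) /\ continuous (jacobian f).

End Derivatives.

(* [bg], [bg2], [bl], [bl1], [bl2], [bc] stand for the barred constants; [bc]
   is the norm of the matrix c. *)
Record pi_constants (R : realType) := PiConstants {
  bg : R; bg2 : R; bl : R; bl1 : R; bl2 : R; c0 : R; cs : R; bc : R }.

Definition positive_constants (R : realType) (K : pi_constants R) : Prop :=
  [/\ 0 < bg K, 0 < bg2 K, 0 < bl K & 0 < bl1 K] /\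
  [/\ 0 < bl2 K, 0 < c0 K, 0 < cs K & 0 < bc K].

Section Assumptions.
Context {R : realType} {d p : nat}.
Variable K : pi_constants R.

(* In row-vector form, c^T a is [a *m c].  The existence of the first and
   second derivatives occurring in the bounds is made explicit. *)
Record A1 (c : 'M[R]_(p, d)) (g : 'rV[R]_d -> 'rV[R]_p -> 'rV[R]_d) : Prop := {
  A1_norm_c : opnorm c = bc K;
  A1_form : exists g1 : 'rV[R]_d -> 'rV[R]_d, forall x a, g x a = g1 x + a *m c;
  A1_diff : forall x a, differentiable (g^~ a) x;
  A1_diff2 : forall i x a, differentiable ('D_(basis_vec i) (g^~ a)) x;
  A1_growth : forall x a, enorm (g x a) <= bg K * (1 + enorm x + enorm a);
  A1_Dx : forall x a, opnorm (Dmx (g^~ a) x) <= bg K;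
  A1_Dxx : forall x a,
    \sum_(i < d) opnorm (Dmx ('D_(basis_vec i) (g^~ a)) x)
      <= bg2 K / (1 + enorm x) }.

Definition grad_x (l : 'rV[R]_d -> 'rV[R]_p -> R) x a : 'rV[R]_d :=
  grad (l^~ a) x.
Definition grad_a (l : 'rV[R]_d -> 'rV[R]_p -> R) x a : 'rV[R]_p :=
  grad (l x) a.

(* Second derivatives are untransposed library jacobians of gradients: the
   (i, j) entry of [hess_xa l x a] is d/dx_i (d l / da_j), as in the
   product of the column nabla_x by the row nabla_a^T. *)
Definition hess_aa (l : 'rV[R]_d -> 'rV[R]_p -> R) x a : 'M[R]_p :=
  jacobian (grad_a l x) a.
Definition hess_xa (l : 'rV[R]_d -> 'rV[R]_p -> R) x a : 'M[R]_(d, p) :=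
  jacobian ((grad_a l)^~ a) x.
Definition hess_ax (l : 'rV[R]_d -> 'rV[R]_p -> R) x a : 'M[R]_(p, d) :=
  jacobian (grad_x l x) a.
Definition hess_xx (l : 'rV[R]_d -> 'rV[R]_p -> R) x a : 'M[R]_d :=
  jacobian ((grad_x l)^~ a) x.

Definition strictly_convex (l : 'rV[R]_d -> 'rV[R]_p -> R) : Prop :=
  forall x a x' a' (t : R), (x, a) != (x', a') -> 0 < t < 1 ->
    l (t *: x + (1 - t) *: x') (t *: a + (1 - t) *: a')
      < t * l x a + (1 - t) * l x' a'.

Record A2 (l : 'rV[R]_d -> 'rV[R]_p -> R) : Prop := {
  A2_convex : strictly_convex l;
  A2_diff : forall z : 'rV[R]_d * 'rV[R]_p,
    differentiable (fun w : 'rV[R]_d * 'rV[R]_p => l w.1 w.2) z;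
  A2_diff_x : forall z : 'rV[R]_d * 'rV[R]_p,
    differentiable (fun w : 'rV[R]_d * 'rV[R]_p => grad_x l w.1 w.2) z;
  A2_diff_a : forall z : 'rV[R]_d * 'rV[R]_p,
    differentiable (fun w : 'rV[R]_d * 'rV[R]_p => grad_a l w.1 w.2) z;
  A2_growth : forall x a, `|l x a| <= bl K * (1 + enorm x ^+ 2 + enorm a ^+ 2);
  A2_lipschitz : forall x a x' a',
    `|l x a - l x' a'| <=
      bl K * (1 + Num.max (enorm x) (enorm x') + Num.max (enorm a) (enorm a'))
           * (enorm (x - x') + enorm (a - a'));
  A2_grad_a : forall x a, bl1 K * enorm a - c0 K <= enorm (grad_a l x a);
  A2_aa : forall x a, cs K <= opnorm (hess_aa l x a);
  A2_xa : forall x a, opnorm (hess_xa l x a) <= bl2 K;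
  A2_ax : forall x a, opnorm (hess_ax l x a) <= bl2 K;
  A2_xx : forall x a, opnorm (hess_xx l x a) <= bl2 K }.

End Assumptions.

Section Iteration.
Context {R : realType} {d p : nat}.
Variables (rho : R) (g : 'rV[R]_d -> 'rV[R]_p -> 'rV[R]_d)
  (l : 'rV[R]_d -> 'rV[R]_p -> R).

Definition is_argmin (lam : 'rV[R]_d -> 'rV[R]_d) (x : 'rV[R]_d)
    (b : 'rV[R]_p) : Prop :=
  forall b', b' != b ->
    dot (g x b) (lam x) + l x b < dot (g x b') (lam x) + l x b'.

Definition source (lam : 'rV[R]_d -> 'rV[R]_d) (a : 'rV[R]_d -> 'rV[R]_p)
    (x : 'rV[R]_d) (i : 'I_d) : R :=
  \sum_(n < d) Dmx (g^~ (a x)) x n i * lam x 0 n + grad_x l x (a x) 0 i.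

Definition solves_pde (lam : 'rV[R]_d -> 'rV[R]_d) (a : 'rV[R]_d -> 'rV[R]_p)
    (lam' : 'rV[R]_d -> 'rV[R]_d) : Prop :=
  forall x i,
    rho * lam' x 0 i - dot (grad (fun y => lam' y 0 i) x) (g x (a x))
      = source lam a x i.

Definition characteristic (a : 'rV[R]_d -> 'rV[R]_p) (x : 'rV[R]_d)
    (y : R -> 'rV[R]_d) : Prop :=
  [/\ y 0 = x, {within `[0, +oo[, continuous y}
    & forall t : R, 0 < t -> is_derive t 1 y (g (y t) (a (y t)))].

(* Along a characteristic y, the equation reads
   d/dt (exp(- rho t) lam'_i(y(t))) = - exp(- rho t) source_i(y(t));
   integrating over [0, +oo[ gives the representation below. *)
Definition given_by_characteristics (lam : 'rV[R]_d -> 'rV[R]_d)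
    (a : 'rV[R]_d -> 'rV[R]_p) (lam' : 'rV[R]_d -> 'rV[R]_d) : Prop :=
  forall x, exists2 y : R -> 'rV[R]_d, characteristic a x y &
    forall i,
      lebesgue_measure.-integrable `[0, +oo[
        (fun t => (expR (- (rho * t)) * source lam a (y t) i)%:E) /\
      lam' x 0 i =
        \int[lebesgue_measure]_(t in `[0, +oo[)
          (expR (- (rho * t)) * source lam a (y t) i).

Record pi_lambda (lam : nat -> 'rV[R]_d -> 'rV[R]_d)
    (a : nat -> 'rV[R]_d -> 'rV[R]_p) : Prop := {
  pi_init : continuously_differentiable (lam 0%N);
  pi_argmin : forall k x, is_argmin (lam k) x (a k x);
  pi_argmin_smooth : forall k, continuously_differentiable (a k);
  pi_diff : forall k x, differentiable (lam k.+1) x;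
  pi_pde : forall k, solves_pde (lam k) (a k) (lam k.+1);
  pi_char : forall k, given_by_characteristics (lam k) (a k) (lam k.+1) }.

End Iteration.

(* [a_bar], [da_bar], [lam_bar], [dlam_bar] are the bounding constants of
   a^(k), D a^(k), lambda^(k), D lambda^(k); [lam0], [dlam0] are the initial
   values of the last two. *)
Section BoundingConstants.
Context {R : realType}.
Variable K : pi_constants R.

Definition a_of (lam : R) : R := (bc K * lam + c0 K) / bl1 K.
Definition da_of (dlam : R) : R := (bl2 K + bc K * dlam) / cs K.

Variables (rho lam0 dlam0 : R).

Fixpoint lam_bar (k : nat) : R :=
  if k is k'.+1 then
    (bl K + bl K * a_of (lam_bar k') + bg K * lam_bar k')
      / (rho - bg K * (1 + a_of (lam_bar k')))
  else lam0.

Fixpoint dlam_bar (k : nat) : R :=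
  if k is k'.+1 then
    (bl2 K + bl2 K * da_of (dlam_bar k') + bg2 K * lam_bar k'
       + bg K * dlam_bar k')
      / (rho - (bg K + bc K * da_of (dlam_bar k')))
  else dlam0.

Definition a_bar (k : nat) : R := a_of (lam_bar k).
Definition da_bar (k : nat) : R := da_of (dlam_bar k).

Definition C1 : R :=
  Num.sqrt (bc K * bl K * (1 + c0 K / bl1 K) / (bg K * bl1 K)) + c0 K / bl1 K.

Definition C2 : R :=
  (cs K)^-1 *
  (bl2 K + Num.sqrt (cs K * bl2 K + bl2 K ^+ 2
     + bg2 K * Num.sqrt (cs K * (bl K ^+ 2 + c0 K * bl K) / bg K))).

Definition C3 : R :=
  Num.sqrt (bl1 K * bl K * (1 + c0 K / bl1 K) / (bg K * bc K)).

Definition C4 : R :=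
  (bc K)^-1 *
  Num.sqrt (cs K * bl2 K + bl2 K ^+ 2
    + bg2 K * Num.sqrt (cs K * (bl K ^+ 2 + c0 K * bl K) / bg K)).

End BoundingConstants.

(* Main.v *)
Require Import Defs.
From mathcomp Require Import all_boot all_order all_algebra.
From mathcomp Require Import all_classical all_reals all_analysis.
From mathcomp Require Import ring lra.
Import Order.TTheory GRing.Theory Num.Theory.
Import numFieldNormedType.Exports.
Local Open Scope ring_scope.

(** The bounding constants are driven by two scalar recursions, for [lam_bar]
    and for [dlam_bar], to which [a_bar] and [da_bar] are tied by the maps
    [a_of] and [da_of].  These are affine and increasing, with [a_of C3 = C1]
    and [da_of C4 = C2], so it suffices to trap [lam_bar] in the interval
    [0, C3] and [dlam_bar] in [0, C4].  Each recursion step has the form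
    [N / (rho - D)] with [N] and [D] nondecreasing in the previous constants.
    On the box of admissible values, [N] and [D] are largest at the upper
    corner, so the step stays in the box as soon as [D + N / C < rho] there,
    where [C] is the upper end of the interval concerned
    ([div_le_of_threshold]).  The two corner values, for [C = C3] and for
    [C = C4], depend only on the structural constants, and [rho1] is their
    maximum.

    For [lam_bar] the threshold [lam_threshold K C] makes sense for every
    [C > 0]; as a function of [C] it is [A / C + B + bg bc C / bl1] with
    [A = bl (1 + c0 / bl1)], whose minimiser is [C3].  This explains the
    formula for [C3], although any positive bound is invariant once [rho] is
    large enough. *)

Section Invariance.
Set Implicit Arguments.
Unset Strict Implicit.
Context {R : realType}.
Variable K : pi_constants R.
Hypothesis K_gt0 : positive_constants K.

(** Rearranging [D' + N' / C < rho] gives [N' < (rho - D') C]; as [0 <= N'],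
    this both makes the denominator positive and bounds the quotient. *)
Lemma div_le_of_threshold (rho N N' D D' C : R) :
  0 < C -> 0 <= N -> N <= N' -> D <= D' -> D' + N' / C < rho ->
  0 <= N / (rho - D) <= C.
Proof.
move=> C0 N0 NN' DD' hrho.
have hN' : N' < (rho - D') * C by rewrite -ltr_pdivrMr// ltrBrDl.
have hD : 0 < rho - D.
  have : 0 <= N' / C by apply: divr_ge0 (le_trans N0 NN') (ltW C0).
  lra.
rewrite divr_ge0 ?(ltW hD)//= ler_pdivrMr// mulrC.
rewrite (le_trans NN')// (le_trans (ltW hN'))// ler_pM2r//.
by rewrite lerD2l lerN2.
Qed.

Definition lam_threshold (C : R) : R :=
  bg K * (1 + a_of K C) + (bl K + bl K * a_of K C + bg K * C) / C.

Definition dlam_threshold (C C' : R) : R :=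
  bg K + bc K * da_of K C'
  + (bl2 K + bl2 K * da_of K C' + bg2 K * C + bg K * C') / C'.

Lemma a_of_bounds (x C : R) : 0 <= x <= C -> 0 <= a_of K x <= a_of K C.
Proof.
case: K_gt0 => -[? ? ? ?] [? ? ? ?] /andP[x0 xC].
apply/andP; split; first by rewrite divr_ge0 ?addr_ge0 ?mulr_ge0 // ltW.
by rewrite ler_pM2r ?invr_gt0// lerD2r ler_pM2l.
Qed.

Lemma da_of_bounds (x C : R) : 0 <= x <= C -> 0 <= da_of K x <= da_of K C.
Proof.
case: K_gt0 => -[? ? ? ?] [? ? ? ?] /andP[x0 xC].
apply/andP; split; first by rewrite divr_ge0 ?addr_ge0 ?mulr_ge0 // ltW.
by rewrite ler_pM2r ?invr_gt0// lerD2l ler_pM2l.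
Qed.

Lemma lam_bar_bounds (rho lam0 C : R) (k : nat) :
  0 < C -> lam_threshold C < rho -> 0 <= lam0 <= C ->
  0 <= lam_bar K rho lam0 k <= C.
Proof.
move=> C0 hrho h0; case: K_gt0 => -[? ? ? ?] [? ? ? ?].
elim: k => [//|k IH] /=.
have /andP[a0 aC] := a_of_bounds IH; have /andP[x0 xC] := IH.
apply: (div_le_of_threshold C0 _ _ _ hrho).
- exact: addr_ge0 (addr_ge0 (ltW _) (mulr_ge0 (ltW _) a0))
    (mulr_ge0 (ltW _) x0).
- by rewrite !lerD ?ler_pM2l.
- by rewrite ler_pM2l ?lerD2l.
Qed.

(** The bound [C] on [lam_bar] is an input: the recursion for [dlam_bar] is
    driven by [lam_bar], not conversely. *)
Lemma dlam_bar_bounds (rho lam0 dlam0 C C' : R) (k : nat) :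
  0 < C' -> (forall j, 0 <= lam_bar K rho lam0 j <= C) ->
  dlam_threshold C C' < rho -> 0 <= dlam0 <= C' ->
  0 <= dlam_bar K rho lam0 dlam0 k <= C'.
Proof.
move=> C'0 hlam hrho h0; case: K_gt0 => -[? ? ? ?] [? ? ? ?].
elim: k => [//|k IH] /=.
have /andP[a0 aC] := da_of_bounds IH; have /andP[x0 xC] := IH.
have /andP[y0 yC] := hlam k.
apply: (div_le_of_threshold C'0 _ _ _ hrho).
- rewrite !addr_ge0 ?(mulr_ge0 (ltW _) a0) ?(mulr_ge0 (ltW _) x0)
    ?(mulr_ge0 (ltW _) y0)//.
  exact: ltW.
- by rewrite !lerD ?ler_pM2l.
- by rewrite lerD2l ler_pM2l.
Qed.

Lemma C3_gt0 : 0 < C3 K.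
Proof.
case: K_gt0 => -[? ? ? ?] [? ? ? ?].
by rewrite sqrtr_gt0 !(divr_gt0, mulr_gt0, addr_gt0).
Qed.

Lemma C4_gt0 : 0 < C4 K.
Proof.
case: K_gt0 => -[? ? ? ?] [? ? ? ?].
rewrite mulr_gt0 ?invr_gt0// sqrtr_gt0 ltr_wpDr ?(mulr_ge0 (ltW _))
  ?sqrtr_ge0//.
by rewrite addr_gt0 ?mulr_gt0 ?exprn_gt0.
Qed.

Lemma a_of_C3 : a_of K (C3 K) = C1 K.
Proof.
case: K_gt0 => -[? ? ? ?] [? ? ? ?].
rewrite /a_of /C1 /C3 mulrDl; congr (_ + _).
(* The positive factor bc / bl1 goes under the root as its square. *)
rewrite mulrAC -[X in X * _]ger0_norm ?divr_ge0 ?ltW// -sqrtr_sqr.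
rewrite -sqrtrM ?sqr_ge0//.
by congr Num.sqrt; field; rewrite ?gt_eqF.
Qed.

Lemma da_of_C4 : da_of K (C4 K) = C2 K.
Proof.
case: K_gt0 => _ [_ _ _ bc0].
by rewrite /da_of /C4 mulVKf ?gt_eqF// mulrC.
Qed.

End Invariance.

Theorem lemma3p2 (R : realType) (d p : nat) (K : pi_constants R)
    (c : 'M[R]_(p, d)) (g : 'rV[R]_d -> 'rV[R]_p -> 'rV[R]_d)
    (l : 'rV[R]_d -> 'rV[R]_p -> R)
    (K_gt0 : positive_constants K) (g_A1 : A1 K c g) (l_A2 : A2 K l) :
  exists rho1 : R,
    forall (rho : R) (lam : nat -> 'rV[R]_d -> 'rV[R]_d)
      (a : nat -> 'rV[R]_d -> 'rV[R]_p) (lam0 dlam0 : R),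
    0 <= rho -> rho1 < rho ->
    pi_lambda rho g l lam a ->
    (forall x, enorm (lam 0%N x) <= C3 K * (1 + enorm x)) ->
    (forall x, opnorm (Dmx (lam 0%N) x) <= C4 K) ->
    0 < lam0 <= C3 K ->
    (forall x, enorm (lam 0%N x) <= lam0 * (1 + enorm x)) ->
    0 < dlam0 <= C4 K ->
    (forall x, opnorm (Dmx (lam 0%N) x) <= dlam0) ->
    forall k : nat,
      [/\ `|a_bar K rho lam0 k| <= C1 K,
          `|da_bar K rho lam0 dlam0 k| <= C2 K,
          `|lam_bar K rho lam0 k| <= C3 K
        & `|dlam_bar K rho lam0 dlam0 k| <= C4 K].
Proof.
exists (Num.max (lam_threshold K (C3 K)) (dlam_threshold K (C3 K) (C4 K))).
move=> rho lam a lam0 dlam0 _; rewrite gt_max => /andP[hrho hrho'] _ _ _.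
move=> /andP[/ltW l0 lC] _ /andP[/ltW dl0 dlC] _ k.
have hlam j : 0 <= lam_bar K rho lam0 j <= C3 K.
  by apply: lam_bar_bounds => //; [exact: C3_gt0 | rewrite l0].
have hdlam : 0 <= dlam_bar K rho lam0 dlam0 k <= C4 K.
  apply: (dlam_bar_bounds K_gt0 _ (C4_gt0 K_gt0) hlam) => //.
  by rewrite dl0.
have /andP[a0 aC] := a_of_bounds K_gt0 (hlam k).
have /andP[da0 daC] := da_of_bounds K_gt0 hdlam.
have /andP[x0 xC] := hlam k; have /andP[y0 yC] := hdlam.
by split; rewrite ger0_norm// -?(a_of_C3 K_gt0) -?(da_of_C4 K_gt0).
Qed.
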